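(* Let $0<T<\infty$ and let $\tau>0$ be a time step. Suppose the gradient flow $\partial_t\phi=-\mathcal{G}\mu$, $\mu=\mathcal{L}\phi+f(\phi)$ on $\Omega$ is discretized in time up to time $T$ by the iSAV-BE scheme with step $\tau$ and stabilizing parameter $S\ge 0$, namely, for integers $n\ge 0$, \begin{align*} &\frac{1}{\tau}(\phi^{n+1}-\phi^{n}) = -\mathcal{G}\mu^{n+1},\\ &\mu^{n+1} = \mathcal{L}\phi^{n+1}+\frac{\tilde{r}^{n+1}}{\sqrt{\mathcal{F}[\phi^{n}]}}f(\phi^n)+S(\phi^{n+1}-\phi^{n}),\\ &\tilde{r}^{n+1}-r[\phi^{n}] = \frac{1}{2\sqrt{\mathcal{F}[\phi^{n}]}}\int_{\Omega} f(\phi^{n})(\phi^{n+1}-\phi^{n})\,d\mathbf{x}. \end{align*} Suppose the stabilizing parameter $S$ satisfies $$S\ \ge\ S_0:=\frac12\max_{0\le n\le T/\tau-1}\ \max_{\mathbf{x}\in\Omega,\ \rho\in(0,1)}\Big\{f'\big((1-\rho)\phi^{n}(\mathbf{x})+\rho\phi^{n+1}(\mathbf{x})\big)\Big\}.$$ Then the scheme satisfies the discrete dissipation law for the original energy $$\frac{1}{\tau}\left(\mathcal{E}[\phi^{n+1}]-\mathcal{E}[\phi^{n}]\right)\le -\big\|\mathcal{G}^{1/2}\mu^{n+1}\big\|^2,\qquad 0\le n\le T/\tau-1.$$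
   Context: $\Omega\subset\mathbb{R}^d$ ($d=1,2,3$) is a bounded domain with periodic boundary conditions (so that all boundary terms in integration by parts vanish). $\langle\phi,\psi\rangle=\int_\Omega\phi\psi\,d\mathbf{x}$ is the $L^2(\Omega)$ inner product and $\|\cdot\|$ the $L^2(\Omega)$ norm. $\mathcal{G}$ and $\mathcal{L}$ are symmetric nonnegative linear operators, independent of $\phi$; for such an operator $\mathcal{A}$, $\|\mathcal{A}^{1/2}\phi\|:=\langle\phi,\mathcal{A}\phi\rangle^{1/2}$. $F:\mathbb{R}\to\mathbb{R}$ is twice continuously differentiable and $f:=F'$. The free energy is $$\mathcal{E}[\phi]=\frac12\|\mathcal{L}^{1/2}\phi\|^2+\int_\Omega F(\phi)\,d\mathbf{x}.$$ Set $\mathcal{F}[\phi]:=\int_\Omega F(\phi)\,d\mathbf{x}$ and $r[\phi]:=\sqrt{\mathcal{F}[\phi]}$; it is assumed throughout that $\mathcal{F}[\phi]\ge C_0>0$ for all $\phi$, with a constant $C_0$. The functions $\phi^n,\mu^n$ on $\Omega$ are assumed regular enough for all the expressions to make sense; $\phi^0$ is the given initial datum. *)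

(* Defs.v *)
From HB Require Import structures.
From mathcomp Require Import all_boot all_order all_algebra.
From mathcomp Require Import all_classical all_reals all_analysis.
From mathcomp Require Import measurable_realfun lra.

Set Implicit Arguments.
Unset Strict Implicit.
Unset Printing Implicit Defensive.

Import Order.TTheory GRing.Theory Num.Theory.
Import numFieldNormedType.Exports.

Local Open Scope classical_set_scope.
Local Open Scope ring_scope.

(* Product sigma-algebra on row vectors, as for [n.-tuple T] in the library. *)

Definition row_display : measure_display -> measure_display.
Proof. exact. Qed.

Definition row_coord (T : Type) (n : nat) (i : 'I_n) (x : 'rV[T]_n) : T :=
  x ord0 i.

Lemma row_sigma0 d (T : measurableType d) n :
  g_sigma_preimage (@row_coord T n) set0.
Proof. exact: sigma_algebra0. Qed.

Lemma row_sigmaC d (T : measurableType d) n (A : set 'rV[T]_n) :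
  g_sigma_preimage (@row_coord T n) A -> g_sigma_preimage (@row_coord T n) (~` A).
Proof. exact: sigma_algebraC. Qed.

Lemma row_sigma_bigcup d (T : measurableType d) n (A : (set 'rV[T]_n)^nat) :
  (forall i, g_sigma_preimage (@row_coord T n) (A i)) ->
  g_sigma_preimage (@row_coord T n) (\bigcup_i A i).
Proof. exact: sigma_algebra_bigcup. Qed.

HB.instance Definition _ d (T : measurableType d) n :=
  @isMeasurable.Build (row_display d) 'rV[T]_n (g_sigma_preimage (@row_coord T n))
    (@row_sigma0 d T n) (@row_sigmaC d T n) (@row_sigma_bigcup d T n).


Lemma measurable_row_coord d (T : measurableType d) n (i : 'I_n) :
  measurable_fun [set: 'rV[T]_n] (@row_coord T n i).
Proof.
move=> _ Y mY; rewrite setTI; apply: sub_sigma_algebra => /=.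
rewrite -bigcup_seq/=; exists i => /=; first by rewrite mem_index_enum.
by exists Y => //; rewrite setTI.
Qed.

Lemma measurable_fun_rowP d1 d2 (T1 : measurableType d1) (T2 : measurableType d2)
    n (f : T1 -> 'rV[T2]_n) :
  (forall i, measurable_fun [set: T1] (row_coord i \o f)) ->
  measurable_fun [set: T1] f.
Proof.
move=> mf.
suff H : g_sigma_preimage (fun i => @row_coord T2 n i \o f) `<=` measurable.
  move=> _ A mA; apply: H; rewrite g_sigma_preimage_comp.
  by exists A.
apply: smallest_sub; first exact: sigma_algebra_measurable.
case: n => [|n] in f mf *; first by rewrite big_ord0.
rewrite -bigcup_mkord_ord; apply: bigcup_sub => i Ii.
by move=> A [B mB <-]; exact: mf.
Qed.

Lemma open_measurable_row (R : realType) n (U : set 'rV[R]_n) :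
  open U -> measurable U.
Proof.
move=> oU.
pose box (q : 'rV[rat]_n * rat) : set 'rV[R]_n :=
  [set y | forall j, ball (ratr (q.1 ord0 j) : R) (ratr q.2) (y ord0 j)].
have mbox q : measurable (box q).
  have -> : box q = \bigcap_(j in [set: 'I_n])
      (row_coord j @^-1` ball (ratr (q.1 ord0 j) : R) (ratr q.2)).
    by apply/seteqP; split=> y /= h j => [_|]; exact: h.
  apply: fin_bigcap_measurable; first exact: finite_finset.
  move=> j _; rewrite -[X in measurable X]setTI.
  apply: measurable_row_coord => //; exact: measurable_ball.
have -> : U = \bigcup_(q in [set q | box q `<=` U]) box q.
  apply/seteqP; split=> [x Ux|x [q /= + qx]]; last exact.
  have /nbhs_ballP[e /= e0 eU] : nbhs x U by exact: open_nbhs_nbhs.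
  have [r] := rat_in_itvoo (divr_gt0 e0 (ltr0Sn R 1)).
  rewrite in_itv/= => /andP[r0 re].
  have /choice[c cP] (j : 'I_n) : exists c : rat, `|x ord0 j - ratr c| < ratr r.
    have [|c] := @rat_in_itvoo R (x ord0 j - ratr r) (x ord0 j + ratr r); first by lra.
    rewrite in_itv/= => /andP[c1 c2]; exists c.
    by rewrite ltr_norml; apply/andP; split; lra.
  exists (\row_j c j, r) => /=; last first.
    by move=> j; rewrite mxE /ball/= distrC.
  move=> y /= by_; apply: eU; split => // i j; rewrite ord1.
  have := by_ j; rewrite mxE /ball/= => h.
  have -> : x ord0 j - y ord0 j = (x ord0 j - ratr (c j)) + (ratr (c j) - y ord0 j).
    by rewrite addrA subrK.
  apply: le_lt_trans (ler_normD _ _) _.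
  rewrite (splitr e); apply: ltrD; apply: lt_trans re; [exact: cP|exact: h].
rewrite bigcup_mkcond; apply: countable_bigcupT_measurable => [|q].
  exact: countableP.
by case: ifP.
Qed.

Definition row_cons (R : realType) n (p : 'rV[R]_n * R) : 'rV[R]_n.+1 :=
  row_mx p.2%:M p.1 : 'rV[R]_(1 + n).

Lemma row_cons0 (R : realType) n (p : 'rV[R]_n * R) :
  row_cons p ord0 ord0 = p.2.
Proof.
rewrite /row_cons (_ : ord0 = lshift n ord0 :> 'I_(1 + n)); last exact/val_inj.
by rewrite (row_mxEl p.2%:M p.1 ord0 ord0) mxE eqxx.
Qed.

Lemma row_consS (R : realType) n (p : 'rV[R]_n * R) (j : 'I_n) :
  row_cons p ord0 (lift ord0 j) = p.1 ord0 j.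
Proof.
rewrite /row_cons (_ : lift ord0 j = rshift 1 j :> 'I_(1 + n)).
  exact: (row_mxEr p.2%:M p.1 ord0 j).
exact/val_inj.
Qed.

Lemma measurable_row_cons (R : realType) n :
  measurable_fun setT (@row_cons R n).
Proof.
apply: measurable_fun_rowP => i; case: (unliftP ord0 i) => [j ->|->].
  rewrite (_ : _ \o _ = @row_coord R n j \o fst).
    by apply: measurableT_comp => //; exact: measurable_row_coord.
  by apply/funext => p; exact: row_consS.
rewrite (_ : _ \o _ = snd) ?measurable_snd//.
by apply/funext => p; exact: row_cons0.
Qed.

Fixpoint lebesgue_row (R : realType) n : {measure set 'rV[R]_n -> \bar R} :=
  if n is m.+1 then
    measure_function_pushforward__canonical__measure_function_Measure
      (lebesgue_row R m \x @lebesgue_measure R)%E (@measurable_row_cons R m)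
  else dirac (0 : 'rV[R]_0).

Lemma lebesgue_row_box (R : realType) n (A : 'I_n -> set R) :
  (forall i, measurable (A i)) ->
  lebesgue_row R n [set x | forall i, A i (x ord0 i)] =
  (\prod_(i < n) lebesgue_measure (A i))%E.
Proof.
elim: n A => [|n IH] A mA.
  rewrite big_ord0 /= diracE mem_set//.
  by move=> -[].
rewrite big_ord_recl /= /pushforward.
pose B : set 'rV[R]_n := [set x | forall i, A (lift ord0 i) (x ord0 i)].
have mB : measurable B.
  have -> : B = \bigcap_(j in [set: 'I_n]) (row_coord j @^-1` A (lift ord0 j)).
    by apply/seteqP; split=> y /= h j => [_|]; exact: h.
  apply: fin_bigcap_measurable; first exact: finite_finset.
  move=> j _; rewrite -[X in measurable X]setTI.
  exact: measurable_row_coord.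
rewrite (_ : _ @^-1` _ = B `*` A ord0); last first.
  apply/seteqP; split=> -[x t] /= h.
    split=> [i|].
      by have := h (lift ord0 i); rewrite row_consS.
    by have := h ord0; rewrite row_cons0.
  move=> i; case: (unliftP ord0 i) => [j ->|->].
    by rewrite row_consS; exact: h.1.
  by rewrite row_cons0; exact: h.2.
rewrite product_measure1E; [|exact: mB|exact: mA].
apply: etrans (muleC _ _) _; congr (_ * _)%E.
by apply: (IH (fun i => A (lift ord0 i))) => i; exact: mA.
Qed.

(* A bounded domain with periodic boundary conditions is an open, connected,
   bounded fundamental domain [cell] of the lattice spanned by the rows of
   [periods]; rectangular boxes correspond to a diagonal [periods]. *)
Record periodic_domain (R : realType) (d : nat) := PeriodicDomain {
  cell : set 'rV[R]_d;
  periods : 'M[R]_d;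
  periods_unit : periods \in unitmx;
  cell_open : open cell;
  cell_connected : connected cell;
  cell_bounded : bounded_set cell;
  cell_disjoint : forall (x : 'rV[R]_d) (k : 'rV[int]_d),
    cell x -> cell (x + map_mx intr k *m periods) -> k = 0;
  cell_cover : \forall x \ae lebesgue_row R d,
    exists k : 'rV[int]_d, cell (x + map_mx intr k *m periods) }.

Section periodic_functions.
Context {R : realType} {d : nat} (Omega : periodic_domain R d).
Local Notation field := ('rV[R]_d -> R).
Implicit Types u v : field.

Definition dx : {measure set 'rV[R]_d -> \bar R} :=
  mrestr (lebesgue_row R d) (open_measurable_row (@cell_open _ _ Omega)).

Definition periodic u := forall (i : 'I_d) x, u (x + row i (periods Omega)) = u x.

Definition L2per : set field := [set u | u \in Lfun dx 2%:E /\ periodic u].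

Definition inner u v : R := \int[dx]_x (u x * v x).

(* Possibly unbounded operators on L^2, acting on representatives: equalities
   between functions are almost everywhere, and [dom] carries the boundary
   conditions and the regularity that the operator requires. *)
Record sym_nonneg_operator := SymNonnegOperator {
  dom : set field;
  op :> field -> field;
  dom_L2 : dom `<=` L2per;
  dom_0 : dom (fun=> 0);
  dom_lin : forall a u v, dom u -> dom v -> dom (fun x => a * u x + v x);
  op_L2 : forall u, dom u -> L2per (op u);
  op_lin : forall a u v, dom u -> dom v ->
    \forall x \ae dx, op (fun y => a * u y + v y) x = a * op u x + op v x;
  op_sym : forall u v, dom u -> dom v -> inner u (op v) = inner (op u) v;
  op_nonneg : forall u, dom u -> 0 <= inner u (op u) }.

Definition half_norm (A : sym_nonneg_operator) u : R := Num.sqrt (inner u (A u)).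

Variables (G L : sym_nonneg_operator) (F : R -> R).

Definition nonlinear_energy u : R := \int[dx]_x F (u x).

Definition energy u : R := 2^-1 * half_norm L u ^+ 2 + nonlinear_energy u.

Definition sav u : R := Num.sqrt (nonlinear_energy u).

Definition finite_energy u : Prop :=
  dom L u /\ dx.-integrable setT (fun x => (F (u x))%:E).

(* Primes mark the values at step n + 1; [m'] is mu and [r'] is r tilde. *)
Definition iSAV_BE_step (tau S : R) u u' m' (r' : R) : Prop :=
  [/\ \forall x \ae dx, tau^-1 * (u' x - u x) = - G m' x,
      \forall x \ae dx, m' x = L u' x
        + r' / Num.sqrt (nonlinear_energy u) * derive1 F (u x) + S * (u' x - u x)
    & r' - sav u = (2 * Num.sqrt (nonlinear_energy u))^-1
        * \int[dx]_x (derive1 F (u x) * (u' x - u x))].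

(* The maximum over the open sets Omega and (0, 1) need not be attained: it is
   read as a supremum in the extended reals; z stands for (x, rho). *)
Definition stab_threshold (T tau : R) (phi : nat -> field) : \bar R :=
  ((2^-1)%:E * ereal_sup
    [set ereal_sup
      [set (derive1 (derive1 F) ((1 - z.2) * phi n z.1 + z.2 * phi n.+1 z.1))%R%:E
        | z in [set z : 'rV[R]_d * R | cell Omega z.1 /\ 0 < z.2 < 1]%R]
      | n in [set n : nat | n%:R <= T / tau - 1 :> R]%R])%E.

End periodic_functions.

Definition twice_continuously_differentiable (R : realType) (F : R -> R) :=
  [/\ forall x, derivable F x 1, forall x, derivable (derive1 F) x 1
    & continuous (derive1 (derive1 F))].

(* Main.v *)
Require Import Defs.
From mathcomp Require Import all_boot all_order all_algebra.
From mathcomp Require Import all_classical all_reals all_analysis.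
From mathcomp Require Import measurable_realfun ring lra.

Set Implicit Arguments.
Unset Strict Implicit.
Unset Printing Implicit Defensive.

Import Order.TTheory GRing.Theory Num.Theory.
Import numFieldNormedType.Exports.

Local Open Scope classical_set_scope.
Local Open Scope ring_scope.

(** Write u, v for two consecutive iterates, w = v - u, m for the new chemical
potential, s = sqrt (F[u]) and f = F'. The proof tests the scheme with w and m
and compares the outcome with the increment of the original energy.

Testing the first equation with m gives <m, w> = - tau |G^(1/2) m|^2, so the
claim reduces to E[v] - E[u] <= <m, w>. Testing the second equation with w gives
<m, w> = <L v, w> + (r~ / s) <f(u), w> + S <w, w>. The point of computing r~
from r[u] = s, the square root of the true nonlinear energy, is that the third
equation makes the scalar factor explicit:
r~ / s = 1 + <f(u), w> / (2 s^2). Hence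
[[
  <m, w> = <L v, w> + <f(u), w> + S <w, w> + <f(u), w>^2 / (2 s^2),
]]
and the last term, the only trace left by the auxiliary variable, is
nonnegative. What remains is bounded below by the two parts of the energy
increment. Since L is nonnegative, its quadratic form lies above its tangents,
so the quadratic part of the increment is at most <L v, w>
([quadratic_energy_increment]). Taylor's formula with F'' <= 2 S on the segments
joining u(x) to v(x), which is what the condition S_0 <= S says
([stab_threshold_bound]), gives F(v) - F(u) <= f(u) w + S w^2 pointwise, and
integration bounds the nonlinear part by <f(u), w> + S <w, w>
([nonlinear_energy_increment]).

Equalities between functions hold almost everywhere, so every substitution
inside an inner product passes through the square-integrable representatives
([inner_aeql]). *)

(** * A one-sided second-order Taylor estimate *)

Lemma is_derive_along_segment (R : realType) (f : R -> R) (a h t : R) :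
  (forall x, derivable f x 1) ->
  is_derive t 1 (fun s => f (a + s * h)) (h * derive1 f (a + t * h)).
Proof.
move=> df.
have dg : is_derive t 1 (fun s : R => a + s * h) h.
  have -> : (fun s => a + s * h) = cst a + (id * cst h) by [].
  apply: is_derive_eq; rewrite /= !scaler0 add0r /GRing.scale/=; ring.
have dfa : is_derive (a + t * h) 1 f (derive1 f (a + t * h)).
  by apply: DeriveDef; [exact: df|rewrite derive1E].
by rewrite mulrC; exact: (is_derive1_comp (g := fun s => a + s * h) dfa dg).
Qed.

(** The second derivative is only bounded from above, and only at interior
points of the segment, so the estimate comes from two applications of the mean
value theorem: one to f' along the segment, then one to the difference of the
two sides along the segment, whose slope is nonpositive by the first. *)
Lemma taylor2_upper_bound (R : realType) (f : R -> R) (a b S : R) :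
  (forall x, derivable f x 1) -> (forall x, derivable (derive1 f) x 1) ->
  (forall s, 0 < s < 1 ->
    derive1 (derive1 f) ((1 - s) * a + s * b) <= 2 * S) ->
  f b - f a <= derive1 f a * (b - a) + S * ((b - a) * (b - a)).
Proof.
move=> df ddf f2S; pose h := b - a.
have slope t : 0 < t < 1 ->
    h * (derive1 f (a + t * h) - derive1 f a) <= 2 * S * t * (h * h).
  move=> /andP[t0 t1].
  have dd s := is_derive_along_segment a h s ddf.
  have cd : {within `[0, t], continuous (fun s => derive1 f (a + s * h))}.
    apply: continuous_subspaceT => s.
    apply: differentiable_continuous; apply/derivable1_diffP.
    exact: (@ex_derive _ _ _ _ _ _ _ (dd s)).
  have [c] := MVT t0 (fun s _ => dd s) cd.
  rewrite in_itv/= mul0r addr0 subr0 => /andP[c0 ct] ->.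
  have := f2S c; rewrite c0 (lt_trans ct t1) => /(_ isT).
  have -> : (1 - c) * a + c * b = a + c * h by rewrite /h; ring.
  move=> fS; have h2 : 0 <= t * (h * h).
    by rewrite mulr_ge0 ?(ltW t0)// -expr2 sqr_ge0.
  have := ler_wpM2r h2 fS; set q := derive1 _ _; lra.
(* Up to the constant f a, this is the left-hand side minus the right-hand side
   at the point a + t * h; it has to decrease from t = 0 to t = 1. *)
pose g t := f (a + t * h) - t * (h * derive1 f a) - t * t * (S * (h * h)).
pose dg t := h * derive1 f (a + t * h) - h * derive1 f a
  - 2 * t * (S * (h * h)).
have dgP (t : R) : is_derive t 1 g (dg t).
  have ? := is_derive_along_segment a h t df.
  have -> : g = (fun t => f (a + t * h)) - (id * cst (h * derive1 f a))
     - (id * id * cst (S * (h * h))) by [].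
  apply: is_derive_eq; rewrite /dg /= !scaler0 /GRing.scale/=; ring.
have cg : {within `[0, 1], continuous g}.
  apply: continuous_subspaceT => s.
  apply: differentiable_continuous; apply/derivable1_diffP.
  exact: (@ex_derive _ _ _ _ _ _ _ (dgP s)).
have [c] := MVT ltr01 (fun s _ => dgP s) cg.
rewrite in_itv/= => /slope; rewrite /dg /g !mul1r !mul0r addr0 !subr0 mulr1.
have -> : a + h = b by rewrite /h; ring.
rewrite -/h; lra.
Qed.

(** * Almost everywhere comparison of real integrals *)

Section Rintegral_almost_everywhere.
Context {d : measure_display} {T : measurableType d} {R : realType}.
Variable m : {measure set T -> \bar R}.
Implicit Types f g : T -> R.

Lemma ae_eq_Rintegral f g : measurable_fun setT f -> measurable_fun setT g ->
  (\forall x \ae m, f x = g x) -> \int[m]_x f x = \int[m]_x g x.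
Proof.
move=> mf mg fg; rewrite /Rintegral; congr fine.
apply: ae_eq_integral => //; [exact/measurable_EFinP|exact/measurable_EFinP|].
by apply: filterS fg => x -> _.
Qed.

(** Replacing g - f by its absolute value changes nothing almost everywhere and
makes the integrand nonnegative at every point. *)
Lemma ae_le_Rintegral f g :
  m.-integrable setT (EFin \o f) -> m.-integrable setT (EFin \o g) ->
  (\forall x \ae m, f x <= g x) -> \int[m]_x f x <= \int[m]_x g x.
Proof.
move=> intf intg fg; rewrite -subr_ge0 -RintegralB//.
have mB : measurable_fun setT (fun x => g x - f x).
  by apply: measurable_funB; apply/measurable_EFinP; exact: (measurable_int m).
rewrite (@ae_eq_Rintegral _ (fun x => `|g x - f x|))//.
- by apply: Rintegral_ge0 => x _; exact: normr_ge0.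
- exact: measurableT_comp.
- by apply: filterS fg => x ?; rewrite ger0_norm ?subr_ge0.
Qed.

End Rintegral_almost_everywhere.

(** * The inner product of square-integrable functions *)

Section inner_product.
Context {R : realType} {d : nat} (Omega : periodic_domain R d).
Local Notation L2 := (Lfun (dx Omega) 2%:E).
Implicit Types u v w : 'rV[R]_d -> R.

Lemma L2_measurable u : u \in L2 -> measurable_fun setT u.
Proof. by move=> /sub_Lfun_mfun; rewrite inE. Qed.

Lemma L2_lin a u v : u \in L2 -> v \in L2 -> (fun x => a * u x + v x) \in L2.
Proof.
move=> u2 v2.
have p1 : (1 <= 2%:E :> \bar R)%E by rewrite lee_fin; lra.
exact: (Lfun_submod_closed (dx Omega) p1).2.
Qed.

Lemma L2_integrable_mul u v : u \in L2 -> v \in L2 ->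
  (dx Omega).-integrable setT (EFin \o (fun x => u x * v x)).
Proof. by move=> u2 v2; apply/Lfun1_integrable/Lfun2_mul_Lfun1. Qed.

Lemma innerC u v : inner Omega u v = inner Omega v u.
Proof. by rewrite /inner; under eq_Rintegral do rewrite mulrC. Qed.

Lemma inner_linl a u v w : u \in L2 -> v \in L2 -> w \in L2 ->
  inner Omega (fun x => a * u x + v x) w
    = a * inner Omega u w + inner Omega v w.
Proof.
move=> u2 v2 w2; have iu := L2_integrable_mul u2 w2.
rewrite /inner -RintegralZl// -RintegralD//; last 2 first.
- rewrite (_ : _ \o _ = fun x => (a%:E * (EFin \o (fun x => (u x * w x)%R)) x)%E)//.
  exact: integrableZl.
- exact: L2_integrable_mul.
by apply: eq_Rintegral => x _; rewrite mulrDl mulrA.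
Qed.

Lemma inner_aeql u v w : u \in L2 -> v \in L2 -> w \in L2 ->
  (\forall x \ae dx Omega, u x = v x) -> inner Omega u w = inner Omega v w.
Proof.
move=> u2 v2 w2 uv; apply: ae_eq_Rintegral.
- by apply: measurable_funM; exact: L2_measurable.
- by apply: measurable_funM; exact: L2_measurable.
- by apply: filterS uv => x ->.
Qed.

(** The pointwise bound on F'' is available inside the cell only; this is what
makes it usable under an integral over the whole space. *)
Lemma ae_cell : \forall x \ae dx Omega, cell Omega x.
Proof.
have mcell := open_measurable_row (@cell_open _ _ Omega).
exists (~` cell Omega); split; first exact: measurableC.
  by rewrite /dx/= /mrestr setICl measure0.
by [].
Qed.

End inner_product.

(** * Increments of the two parts of the energy *)

Section energy_estimates.
Context {R : realType} {d : nat} (Omega : periodic_domain R d).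
Local Notation L2 := (Lfun (dx Omega) 2%:E).
Implicit Types u v w : 'rV[R]_d -> R.
Variables (A : sym_nonneg_operator Omega) (F : R -> R).

Lemma domL2 u : dom A u -> u \in L2.
Proof. by move=> /dom_L2[]. Qed.

Lemma opL2 u : dom A u -> A u \in L2.
Proof. by move=> /op_L2[]. Qed.

Lemma half_norm_sqr u : dom A u -> half_norm A u ^+ 2 = inner Omega u (A u).
Proof. by move=> du; rewrite /half_norm sqr_sqrtr// op_nonneg. Qed.

(** The difference of the two sides is half of <v - u, A (v - u)>. *)
Lemma quadratic_energy_increment u v : dom A u -> dom A v ->
  2^-1 * inner Omega v (A v) - 2^-1 * inner Omega u (A u)
    <= inner Omega (A v) (fun x => v x - u x).
Proof.
move=> du dv.
pose w x := -1 * u x + v x.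
have -> : (fun x => v x - u x) = w by apply/funext => x; rewrite /w; ring.
have dw : dom A w by exact: dom_lin.
have [[u2 v2] w2] := (domL2 du, domL2 dv, domL2 dw).
have [[Au2 Av2] Aw2] := (opL2 du, opL2 dv, opL2 dw).
have inner_Aw y (h : y \in L2) : inner Omega y (A w)
    = - inner Omega y (A u) + inner Omega y (A v).
  rewrite innerC (inner_aeql Aw2 _ h (op_lin (-1) du dv)); last exact: L2_lin.
  by rewrite inner_linl// mulN1r !(innerC _ y).
have w_inner y (h : y \in L2) :
    inner Omega w y = - inner Omega u y + inner Omega v y.
  by rewrite /w inner_linl// mulN1r.
have uv : inner Omega u (A v) = inner Omega v (A u) by rewrite op_sym// innerC.
have := op_nonneg dw.
by rewrite (innerC _ (A v)) !w_inner// !inner_Aw// uv; lra.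
Qed.

(** This is the pointwise Taylor estimate integrated over the cell; the
quadratic remainder is absorbed by the stabilizing term S w. *)
Lemma nonlinear_energy_increment (S : R) u v :
  (forall x, derivable F x 1) -> (forall x, derivable (derive1 F) x 1) ->
  (forall x s, cell Omega x -> 0 < s < 1 ->
    derive1 (derive1 F) ((1 - s) * u x + s * v x) <= 2 * S) ->
  (dx Omega).-integrable setT (EFin \o (F \o u)) ->
  (dx Omega).-integrable setT (EFin \o (F \o v)) ->
  u \in L2 -> v \in L2 -> (fun x => derive1 F (u x)) \in L2 ->
  nonlinear_energy Omega F v - nonlinear_energy Omega F u
    <= inner Omega (fun x => derive1 F (u x)) (fun x => v x - u x)
       + S * inner Omega (fun x => v x - u x) (fun x => v x - u x).
Proof.
move=> dF ddF F2S iu iv u2 v2 fu2.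
have w2 : (fun x => v x - u x) \in L2.
  have -> : (fun x => v x - u x) = (fun x => -1 * u x + v x).
    by apply/funext => x; ring.
  exact: L2_lin.
rewrite /nonlinear_energy -RintegralB// addrC -inner_linl//.
apply: ae_le_Rintegral.
- exact: (integrableB measurableT iv iu).
- by apply: L2_integrable_mul => //; exact: L2_lin.
apply: filterS (ae_cell Omega) => x cx.
have := taylor2_upper_bound dF ddF (fun s => F2S x s cx).
by move=> /le_trans; apply; lra.
Qed.

End energy_estimates.

(** A nested supremum of extended reals is unfolded to a real bound at a given
step n, point x of the cell and s in (0, 1); the factor 2 is the inverse of the
1/2 in S_0. *)
Lemma stab_threshold_bound (R : realType) d (Omega : periodic_domain R d)
    (F : R -> R) (T tau S : R) (phi : nat -> 'rV[R]_d -> R) (n : nat) x s :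
  (stab_threshold Omega F T tau phi <= S%:E)%E -> n%:R <= T / tau - 1 ->
  cell Omega x -> 0 < s < 1 ->
  derive1 (derive1 F) ((1 - s) * phi n x + s * phi n.+1 x) <= 2 * S.
Proof.
move=> + nT cx s01; rewrite /stab_threshold lee_pdivrMl// => supS.
rewrite -lee_fin EFinM; apply: le_trans supS.
apply: le_trans; last by apply: ereal_sup_ubound; exists n.
by apply: ereal_sup_ubound; exists (x, s).
Qed.

Theorem theorem2p1 (R : realType) (d : nat) (hd : (1 <= d <= 3)%N)
    (Omega : periodic_domain R d) (G L : sym_nonneg_operator Omega)
    (F : R -> R) (hF : twice_continuously_differentiable F)
    (C0 : R) (hC0 : 0 < C0)
    (hF0 : forall u, finite_energy L F u -> C0 <= nonlinear_energy Omega F u)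
    (T tau S : R) (hT : 0 < T) (htau : 0 < tau) (hS : 0 <= S)
    (phi mu : nat -> 'rV[R]_d -> R) (r : nat -> R)
    (hphi : forall n : nat, n%:R <= T / tau -> finite_energy L F (phi n))
    (hf : forall n : nat, n%:R <= T / tau - 1 ->
      (fun x => derive1 F (phi n x)) \in Lfun (dx Omega) 2%:E)
    (hmu : forall n : nat, n%:R <= T / tau - 1 -> dom G (mu n.+1))
    (hscheme : forall n : nat, n%:R <= T / tau - 1 ->
      iSAV_BE_step G L F tau S (phi n) (phi n.+1) (mu n.+1) (r n.+1))
    (hS0 : (stab_threshold Omega F T tau phi <= S%:E)%E) :
  forall n : nat, n%:R <= T / tau - 1 ->
    tau^-1 * (energy L F (phi n.+1) - energy L F (phi n))
      <= - half_norm G (mu n.+1) ^+ 2.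
Proof.
move=> n nT; case: hF => dF ddF _.
have [du iu] : finite_energy L F (phi n) by apply: hphi; lra.
have [dv iv] : finite_energy L F (phi n.+1) by apply: hphi; rewrite -natr1; lra.
have E0 : 0 < nonlinear_energy Omega F (phi n).
  by apply: lt_le_trans hC0 _; exact: hF0.
have [eqphi eqmu eqr] := hscheme n nT.
have dm := hmu n nT; have fu2 := hf n nT.
have [[[u2 v2] m2] Gm2] := (domL2 du, domL2 dv, domL2 dm, opL2 dm).
have Lv2 := opL2 dv.
have incF := nonlinear_energy_increment dF ddF
  (fun x s => stab_threshold_bound hS0 nT) iu iv u2 v2 fu2.
have incL := quadratic_energy_increment du dv.
rewrite /energy !half_norm_sqr//.
set w := (fun x => phi n.+1 x - phi n x) in incF incL.
have w2 : w \in Lfun (dx Omega) 2%:E.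
  have -> : w = (fun x => -1 * phi n x + phi n.+1 x).
    by apply/funext => x; rewrite /w; ring.
  exact: L2_lin.
pose f := fun x => derive1 F (phi n x).
pose s := Num.sqrt (nonlinear_energy Omega F (phi n)).
have s0 : 0 < s by rewrite sqrtr_gt0.
pose c := r n.+1 / s.
have dissip : inner Omega w (mu n.+1)
    = - tau * inner Omega (mu n.+1) (G (mu n.+1)).
  (* The closure lemma for square-integrable functions has the form a * u + v, so
     - tau * G m is written with a zero second summand. *)
  have zero2 : (fun=> 0) \in Lfun (dx Omega) 2%:E by exact: domL2 (dom_0 G).
  have tG2 := L2_lin (- tau) Gm2 zero2.
  rewrite (inner_aeql w2 tG2 m2); last first.
    apply: filterS eqphi => x e; rewrite addr0 mulNr -mulrN -e mulVKf//.
    by rewrite gt_eqF.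
  rewrite inner_linl// (innerC _ (G _)) (_ : inner _ (fun=> 0) _ = 0) ?addr0//.
  rewrite /inner; under eq_Rintegral do rewrite mul0r.
  by rewrite Rintegral_cst// mul0r.
have work : inner Omega (mu n.+1) w = inner Omega (L (phi n.+1)) w
    + c * inner Omega f w + S * inner Omega w w.
  pose g x := S * w x + (c * f x + L (phi n.+1) x).
  have cfL2 := L2_lin c fu2 Lv2.
  have g2 : g \in Lfun (dx Omega) 2%:E by exact: L2_lin.
  rewrite (inner_aeql m2 g2 w2); last first.
    by apply: filterS eqmu => x ->; rewrite /g /c /s /f /w; ring.
  by rewrite /g inner_linl// inner_linl//; ring.
(* The scalar factor r~ / s exceeds 1 by <f(u), w> / (2 s^2). *)
have ratio : c * inner Omega f w
    = inner Omega f w + (2 * (s * s))^-1 * (inner Omega f w * inner Omega f w).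
  have rE : r n.+1 = s + (2 * s)^-1 * inner Omega f w.
    move: eqr; rewrite /sav -/s /inner -/f -/w => /eqP.
    by rewrite subr_eq addrC => /eqP.
  by rewrite /c rE; field; rewrite gt_eqF.
have square : 0 <= (2 * (s * s))^-1 * (inner Omega f w * inner Omega f w).
  rewrite mulr_ge0 ?invr_ge0 -?expr2 ?sqr_ge0//.
  by rewrite mulr_ge0// sqr_ge0.
rewrite mulrC ler_pdivrMr//.
move: dissip; rewrite innerC work ratio.
move: incF; rewrite -/f; lra.
Qed.
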